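(* Let $q\in(0,1)$. There is a positive constant $K$ such that for all $n$, all $x\in[0,\infty)$ and all $f\in C_B[0,\infty)$, $$\left|P^{\ast}_n(f;q;x)-f(x)\right|\le K\,\omega_2\left(f,\varphi_n\right)+\omega\left(f,\frac{(D_qA)(1)}{A(1)}\,\frac{b_n}{[n]_q}\right),$$ where $$\varphi_n=\frac{q(D_qA)(q)+(D_qA)(1)}{A(1)}\,\frac{b_n}{[n]_q}+\frac{A(1)\,(D_q^2A)(1)+[(D_qA)(1)]^2}{A^2(1)}\,\frac{b_n^2}{[n]_q^2}.$$
   Context: $C_B[0,\infty)$ is the space of real-valued continuous bounded functions on $[0,\infty)$. For $\delta>0$, the second order modulus of smoothness and the modulus of continuity of $f$ are $$\omega_2(f,\delta)=\sup_{0<h\le\delta}\ \sup_{x\in[0,\infty)}|f(x+2h)-2f(x+h)+f(x)|,\qquad \omega(f,\delta)=\sup_{0<h\le\delta}\ \sup_{x\in[0,\infty)}|f(x+h)-f(x)|.$$ For $0<q<1$: $[r]_q=\frac{1-q^r}{1-q}$; $[n]_q!=[n]_q[n-1]_q\cdots[1]_q$ for $n\ge 1$ and $[0]_q!=1$. The $q$-derivative is $(D_qf)(x)=\frac{f(x)-f(qx)}{(1-q)x}$ for $x\neq 0$ (and $(D_qf)(0)=f'(0)$ if this exists); $D_q^2=D_q\circ D_q$. The $q$-exponentials are $e_q^x=\sum_{n=0}^\infty \frac{x^n}{[n]_q!}$ and $E_q^x=\sum_{n=0}^\infty q^{n(n-1)/2}\frac{x^n}{[n]_q!}$. $(b_n)$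 is a positive increasing sequence with $\lim_n b_n=\infty$ and $\lim_n b_n/n=0$. $A(u)=\sum_{k=0}^\infty a_ku^k$ is analytic in a disc $|u|<R$ with $R>1$, and $A(1)\ne 0$. The $q$-Appell polynomials $P_k(q;\cdot)$, assumed to satisfy $P_k(q;\cdot)\ge 0$ on $[0,\infty)$, are defined by the generating relation (power series in $u$) $$A(u)\,e_q^{\frac{[n]_q}{b_n}xu}=\sum_{k=0}^\infty \frac{P_k\left(q;\frac{[n]_q}{b_n}x\right)u^k}{[k]_q!}.$$ The Choldowsky type $q$-Favard-Szász operators are $$P^{\ast}_n(f;q;x)=\frac{E_q^{-\frac{[n]_q}{b_n}x}}{A(1)}\sum_{k=0}^\infty\frac{P_k\left(q;\frac{[n]_q}{b_n}x\right)}{[k]_q!}\,f\left(\frac{[k]_q}{[n]_q}b_n\right).$$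
   Formalization: The estimate is stated for n ≥ 1 and those x ≥ 0 at which the series of P*_n converges for every function in C_B (it diverges for f = 1 when x ≥ b_n/(1−q^n)), and only when both arguments of the moduli are positive, which excludes constant A. *)

(* Defs.v *)
From Stdlib Require Import Reals Lra.
From Coquelicot Require Import Coquelicot.

Open Scope R_scope.

Definition qint (q : R) (n : nat) : R := (1 - q ^ n) / (1 - q).

Fixpoint qfact (q : R) (n : nat) : R :=
  match n with
  | O => 1
  | S m => qint q (S m) * qfact q m
  end.

Definition Dq (q : R) (f : R -> R) (x : R) : R :=
  if Req_dec_T x 0 then Derive f 0
  else (f x - f (q * x)) / ((1 - q) * x).

(* For 0 < q < 1 this series converges exactly when |x| < 1 / (1 - q). *)
Definition qexp (q x : R) : R := Series (fun n => x ^ n / qfact q n).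

(* For 0 < q < 1 this series converges for every x. *)
Definition qExp (q x : R) : R :=
  Series (fun n => q ^ (n * (n - 1) / 2) * (x ^ n / qfact q n)).

(* Elements of C_B[0,oo) are functions on R of which only the values on [0,oo)
   matter; continuity at 0 is one-sided. *)
Definition CB (f : R -> R) : Prop :=
  continuous_on (fun x => 0 <= x) f /\
  exists M : R, forall x : R, 0 <= x -> Rabs (f x) <= M.

(* Both moduli are meaningful for f in C_B[0,oo) and delta > 0 only: the sets
   are then nonempty and bounded, so that the least upper bound is finite. *)
Definition omega (f : R -> R) (delta : R) : R :=
  real (Lub_Rbar (fun y => exists h x : R,
    0 < h <= delta /\ 0 <= x /\ y = Rabs (f (x + h) - f x))).

Definition omega2 (f : R -> R) (delta : R) : R :=
  real (Lub_Rbar (fun y => exists h x : R,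
    0 < h <= delta /\ 0 <= x /\
    y = Rabs (f (x + 2 * h) - 2 * f (x + h) + f x))).

(* The generating relation A(u) e_q^(y u) = sum_k P_k(y) u^k / [k]_q! is an
   identity of power series in u, i.e. an identity for u near 0; how near
   depends on y, since e_q^(y u) has finite radius of convergence in u. *)
Definition is_qAppell (q : R) (A : R -> R) (P : nat -> R -> R) : Prop :=
  forall y : R,
    locally 0 (fun u : R =>
      is_pseries (fun k => P k y / qfact q k) u (A u * qexp q (y * u))).

Definition FS_term (q : R) (b : nat -> R) (P : nat -> R -> R)
    (n : nat) (f : R -> R) (x : R) (k : nat) : R :=
  P k (qint q n / b n * x) / qfact q k * f (qint q k / qint q n * b n).

Definition FS (q : R) (b : nat -> R) (A : R -> R) (P : nat -> R -> R)
    (n : nat) (f : R -> R) (x : R) : R :=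
  qExp q (- (qint q n / b n * x)) / A 1 * Series (FS_term q b P n f x).

(* The operator is defined at x on all of C_B[0,oo). For q-Appell polynomials
   that are nonnegative on [0,oo), with A(1) <> 0, and for x >= 0, this amounts
   to the convergence of e_q^(([n]_q / b_n) x), that is to x < b_n / (1 - q^n). *)
Definition FS_defined (q : R) (b : nat -> R) (P : nat -> R -> R)
    (n : nat) (x : R) : Prop :=
  forall g : R -> R, CB g -> ex_series (FS_term q b P n g x).

Definition phi (q : R) (b : nat -> R) (A : R -> R) (n : nat) : R :=
  (q * Dq q A q + Dq q A 1) / A 1 * (b n / qint q n)
  + (A 1 * Dq q (Dq q A) 1 + (Dq q A 1) ^ 2) / (A 1) ^ 2
    * ((b n) ^ 2 / (qint q n) ^ 2).

(* Main.v *)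
Require Import Defs.
From Stdlib Require Import Reals Lra Lia Arith.
From Coquelicot Require Import Coquelicot.

Open Scope R_scope.

(** Write beta = b_n / [n]_q, y = x / beta and d = (D_q A)(1) / A(1).  The value
    of the operator at [x] is an average of [f]: the weights
    [c P_k(y) / [k]_q!], with [c = E_q(-y) / A(1)], are nonnegative and have
    sum 1 because e_q(y) E_q(-y) = 1 ([qexp_mul_qExp_opp]).  Two facts about this
    average suffice.

    Its nodes [k]_q beta all lie in [[0, T]] with T = beta / (1 - q), since
    [k]_q < 1 / (1 - q).  Thus the operator is local on the scale beta.

    Its barycentre is x + d beta (1 - (1 - q) y).  Indeed
    [k]_q = (1 - q^k) / (1 - q), so the mean is a difference of the generating
    function at u = 1 and at u = q, and e_q(q y) = (1 - (1 - q) y) e_q(y).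
    Convergence of the operator forces (1 - q) y < 1 ([appell_convergence]), so
    the barycentre exceeds [x] by a positive amount at most d beta: replacing
    [f] at the barycentre by [f x] costs at most omega(f, d beta).

    It remains to compare an average over [[0, T]] with the value at the
    barycentre.  Nonnegativity of the polynomials makes all a_k nonnegative
    ([appell_coef_nonneg]), hence all q-derivatives in phi_n nonnegative
    ([Dq_pos_coef]), whence phi_n >= d beta.  So [T] is at most a fixed
    multiple of phi_n, and after m doublings of the step
    ([second_diff_pow2]) the chord of [f] over [[0, T]] approximates [f] within
    4^m omega_2(f, phi_n) ([near_affine]).  Averages reproduce affine functions,
    so the difference is at most twice this error ([average_deviation]), and
    K = 2 * 4^m works with 2^m >= 1 / (d (1 - q)). *)

(** * Sums of real series *)

Lemma is_series_le (u v : nat -> R) (lu lv : R) :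
  (forall k, u k <= v k) -> is_series u lu -> is_series v lv -> lu <= lv.
Proof.
  intros H Hu Hv.
  assert (Rbar_le lu lv) as HH; [|exact HH].
  apply is_lim_seq_le with (sum_n u) (sum_n v); [|exact Hu|exact Hv].
  intros n. apply sum_n_m_le. exact H.
Qed.

Lemma is_series_lin (c d : R) (u v : nat -> R) (lu lv : R) :
  is_series u lu -> is_series v lv ->
  is_series (fun k => c * u k + d * v k) (c * lu + d * lv).
Proof.
  intros Hu Hv.
  apply (is_series_plus (fun k => c * u k) (fun k => d * v k)).
  - apply (is_series_scal c u lu Hu).
  - apply (is_series_scal d v lv Hv).
Qed.

Lemma is_series_eq (u v : nat -> R) (l m : R) :
  is_series u l -> (forall k, u k = v k) -> l = m -> is_series v m.
Proof.
  intros H E <-. exact (is_series_ext u v l E H).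
Qed.

(** Used to turn a recursion between consecutive coefficients into a
    functional equation for the sum. *)
Lemma is_series_shift (u v : nat -> R) (c l : R) :
  is_series u l -> v 0%nat = 0 -> (forall n, v (S n) = c * u n) ->
  is_series v (c * l).
Proof.
  intros Hu H0 HS. apply is_series_decr_1.
  apply is_series_eq with (fun n => c * u n) (c * l).
  - apply (is_series_scal c u l Hu).
  - intros n. symmetry. apply HS.
  - rewrite H0. unfold plus, opp. simpl. ring.
Qed.

(** * Moduli of smoothness *)

(** The bound [B] excludes the value [p_infty], whose real part would be [0]. *)
Lemma le_real_Lub (E : R -> Prop) (B y : R) :
  (forall z, E z -> z <= B) -> E y -> y <= real (Lub_Rbar E).
Proof.
  intros HB Hy.
  destruct (Lub_Rbar_correct E) as [H1 H2].
  specialize (H1 y Hy).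
  assert (H3 : Rbar_le (Lub_Rbar E) B) by (apply H2; intros z Hz; exact (HB z Hz)).
  destruct (Lub_Rbar E); simpl in *; tauto.
Qed.

Definition second_diff_bound (f : R -> R) (d W : R) : Prop :=
  forall h x : R, 0 < h <= d -> 0 <= x ->
    Rabs (f (x + 2 * h) - 2 * f (x + h) + f x) <= W.

Lemma omega2_bound (f : R -> R) (M d : R) :
  (forall x, 0 <= x -> Rabs (f x) <= M) ->
  second_diff_bound f d (omega2 f d).
Proof.
  intros HM h x Hh Hx. unfold omega2.
  apply le_real_Lub with (4 * M); [|exists h, x; repeat split; tauto].
  intros z (k & t & Hk & Ht & ->).
  assert (H1 := HM (t + 2 * k) ltac:(lra)).
  assert (H2 := HM (t + k) ltac:(lra)).
  assert (H3 := HM t Ht).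
  apply Rabs_le_between in H1, H2, H3.
  apply Rabs_le_between. lra.
Qed.

Lemma omega_bound (f : R -> R) (M d h x : R) :
  (forall x, 0 <= x -> Rabs (f x) <= M) ->
  0 < h <= d -> 0 <= x -> Rabs (f (x + h) - f x) <= omega f d.
Proof.
  intros HM Hh Hx. unfold omega.
  apply le_real_Lub with (2 * M); [|exists h, x; repeat split; tauto].
  intros z (k & t & Hk & Ht & ->).
  assert (H1 := HM (t + k) ltac:(lra)).
  assert (H3 := HM t Ht).
  apply Rabs_le_between in H1, H3.
  apply Rabs_le_between. lra.
Qed.

(** A second difference of step [h] is the combination, with weights 1, 2, 1,
    of the second differences of step [h / 2] at [x + h], [x + h / 2], [x]. *)
Lemma second_diff_double (f : R -> R) (d W : R) :
  second_diff_bound f d W -> second_diff_bound f (2 * d) (4 * W).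
Proof.
  intros H h x Hh Hx.
  assert (H0 := H (h / 2) x ltac:(lra) Hx).
  assert (H1 := H (h / 2) (x + h / 2) ltac:(lra) ltac:(lra)).
  assert (H2 := H (h / 2) (x + h) ltac:(lra) ltac:(lra)).
  replace (x + 2 * (h / 2)) with (x + h) in H0 by field.
  replace (x + h / 2 + 2 * (h / 2)) with (x + h + h / 2) in H1 by field.
  replace (x + h / 2 + h / 2) with (x + h) in H1 by field.
  replace (x + h + 2 * (h / 2)) with (x + 2 * h) in H2 by field.
  apply Rabs_le_between in H0, H1, H2.
  apply Rabs_le_between. lra.
Qed.

Lemma second_diff_pow2 (f : R -> R) (d W : R) (m : nat) :
  second_diff_bound f d W -> second_diff_bound f (2 ^ m * d) (4 ^ m * W).
Proof.
  intros H. induction m as [|m IH].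
  - simpl. rewrite !Rmult_1_l. exact H.
  - simpl. rewrite !Rmult_assoc. apply second_diff_double. exact IH.
Qed.

(** An elementary Whitney inequality.  Subtract the chord of [f] over [[0, T]];
    the remainder [g] vanishes at both ends and has the same second differences
    as [f].  Reflecting the nearer end point in [t] stays inside [[0, T]] and
    gives [2 |g t| <= W + S] with [S] the supremum of [|g|], hence
    [S <= (W + S) / 2] and [S <= W]. *)
Lemma near_affine (f : R -> R) (M d W T : R) :
  (forall x, 0 <= x -> Rabs (f x) <= M) ->
  second_diff_bound f d W -> 0 < T <= 2 * d ->
  exists al be, forall t, 0 <= t <= T -> Rabs (f t - (al + be * t)) <= W.
Proof.
  intros HM HW HT.
  set (be := (f T - f 0) / T).
  exists (f 0), be.
  set (g := fun t => f t - (f 0 + be * t)).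
  change (forall t, 0 <= t <= T -> Rabs (g t) <= W).
  assert (g0 : g 0 = 0) by (unfold g; ring).
  assert (gT : g T = 0) by (unfold g, be; field; lra).
  assert (HW' : second_diff_bound g d W).
  { intros h x Hh Hx. unfold g.
    replace (_ - _ + _) with (f (x + 2 * h) - 2 * f (x + h) + f x) by ring.
    exact (HW h x Hh Hx). }
  assert (HW0 : 0 <= W).
  { apply Rle_trans with (2 := HW d 0 ltac:(lra) ltac:(lra)). apply Rabs_pos. }
  destruct (completeness (fun y => exists t, 0 <= t <= T /\ y = Rabs (g t)))
    as [S [HS1 HS2]].
  - exists (2 * M + Rabs be * T + M). intros y (t & Ht & ->). unfold g.
    assert (H1 := HM t (proj1 Ht)). assert (H2 := HM 0 (Rle_refl 0)).
    assert (H3 : Rabs (be * t) <= Rabs be * T).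
    { rewrite Rabs_mult, (Rabs_pos_eq t) by lra.
      apply Rmult_le_compat_l; [apply Rabs_pos | lra]. }
    apply Rabs_le_between in H1, H2, H3.
    apply Rabs_le_between. lra.
  - exists (Rabs (g 0)), 0. split; [lra | reflexivity].
  - assert (HS : forall t, 0 <= t <= T -> Rabs (g t) <= S).
    { intros t Ht. apply HS1. exists t. split; [exact Ht | reflexivity]. }
    assert (HS0 : 0 <= S).
    { assert (H := HS 0 ltac:(lra)). rewrite g0, Rabs_R0 in H. exact H. }
    assert (Hhalf : forall t, 0 <= t <= T -> Rabs (g t) <= (W + S) / 2).
    { intros t Ht.
      destruct (Req_dec t 0) as [-> | Ht0]; [rewrite g0, Rabs_R0; lra |].
      destruct (Req_dec t T) as [-> | HtT]; [rewrite gT, Rabs_R0; lra |].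
      destruct (Rle_dec t (T / 2)) as [Hle | Hgt].
      - assert (H1 := HW' t 0 ltac:(lra) ltac:(lra)).
        assert (H2 := HS (2 * t) ltac:(lra)).
        rewrite !Rplus_0_l, g0 in H1.
        apply Rabs_le_between in H1, H2. apply Rabs_le_between. lra.
      - assert (H1 := HW' (T - t) (2 * t - T) ltac:(lra) ltac:(lra)).
        assert (H2 := HS (2 * t - T) ltac:(lra)).
        replace (2 * t - T + 2 * (T - t)) with T in H1 by ring.
        replace (2 * t - T + (T - t)) with t in H1 by ring.
        rewrite gT in H1.
        apply Rabs_le_between in H1, H2. apply Rabs_le_between. lra. }
    assert (S <= (W + S) / 2).
    { apply HS2. intros y (t & Ht & ->). exact (Hhalf t Ht). }
    intros t Ht. assert (H1 := HS t Ht). lra.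
Qed.

(** An average of values of [f] reproduces affine functions, so the distance to
    the value at the barycentre [mu] only sees the error of an affine
    approximation, once in the average and once at [mu]. *)
Lemma average_deviation (v t : nat -> R) (mu T F W al be : R) (f : R -> R) :
  (forall k, 0 <= v k) -> (forall k, 0 <= t k <= T) ->
  is_series v 1 -> is_series (fun k => v k * t k) mu ->
  is_series (fun k => v k * f (t k)) F ->
  (forall s, 0 <= s <= T -> Rabs (f s - (al + be * s)) <= W) ->
  Rabs (F - f mu) <= 2 * W.
Proof.
  intros Hv Ht H1 Hmu HF Haff.
  assert (Hmu0 : 0 <= mu <= T).
  { split.
    - replace 0 with (0 * 1 + 0 * 1) by ring.
      apply (fun H => is_series_le _ _ _ _ H (is_series_lin 0 0 v v 1 1 H1 H1) Hmu).
      intros k. assert (0 <= v k * t k) by (apply Rmult_le_pos; [apply Hv | apply Ht]).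
      lra.
    - replace T with (T * 1 + 0 * 1) by ring.
      apply (fun H => is_series_le _ _ _ _ H Hmu (is_series_lin T 0 v v 1 1 H1 H1)).
      intros k. assert (v k * t k <= v k * T)
        by (apply Rmult_le_compat_l; [apply Hv | apply Ht]).
      lra. }
  assert (Hbd := Haff mu Hmu0).
  assert (HL := is_series_lin al be _ _ _ _ H1 Hmu).
  assert (HU := is_series_lin 1 W _ _ _ _ HL H1).
  assert (HD := is_series_lin 1 (- W) _ _ _ _ HL H1).
  assert (Hk : forall k, v k * (al + be * t k - W) <= v k * f (t k)
                         <= v k * (al + be * t k + W)).
  { intros k. assert (H := Haff (t k) (Ht k)). apply Rabs_le_between in H.
    split; apply Rmult_le_compat_l; try apply Hv; lra. }
  assert (F <= 1 * (al * 1 + be * mu) + W * 1).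
  { apply (fun H => is_series_le _ _ _ _ H HF HU).
    intros k. assert (H := Hk k). lra. }
  assert (1 * (al * 1 + be * mu) + - W * 1 <= F).
  { apply (fun H => is_series_le _ _ _ _ H HD HF).
    intros k. assert (H' := Hk k). lra. }
  apply Rabs_le_between in Hbd. apply Rabs_le_between. lra.
Qed.

(** * The q-exponential functions *)

Lemma qint_bounds (q : R) (n : nat) : 0 < q < 1 -> 0 <= qint q n < / (1 - q).
Proof.
  intros hq. unfold qint, Rdiv.
  assert (0 < q ^ n) by (apply pow_lt; lra).
  assert (0 < / (1 - q)) by (apply Rinv_0_lt_compat; lra).
  assert (q ^ n <= 1) by (rewrite <- (pow1 n); apply pow_incr; lra).
  split; [apply Rmult_le_pos; lra |].
  rewrite <- (Rmult_1_l (/ (1 - q))) at 2. apply Rmult_lt_compat_r; lra.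
Qed.

Lemma qint_S_pos (q : R) (n : nat) : 0 < q < 1 -> 0 < qint q (S n).
Proof.
  intros hq. unfold qint. apply Rdiv_lt_0_compat; [|lra].
  assert (q ^ n <= 1) by (rewrite <- (pow1 n); apply pow_incr; lra).
  assert (0 < q ^ n) by (apply pow_lt; lra).
  simpl. nra.
Qed.

Lemma qfact_pos (q : R) (n : nat) : 0 < q < 1 -> 0 < qfact q n.
Proof.
  intros hq. induction n as [|n IH]; simpl; [lra|].
  apply Rmult_lt_0_compat; [apply qint_S_pos; lra | exact IH].
Qed.

Lemma one_sub_pow (q : R) (n : nat) : 0 < q < 1 ->
  1 - q ^ n = (1 - q) * qint q n.
Proof. intros hq. unfold qint. field. lra. Qed.

Lemma one_sub_pow_div_qfact (q : R) (n : nat) : 0 < q < 1 ->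
  (1 - q ^ S n) / qfact q (S n) = (1 - q) / qfact q n.
Proof.
  intros hq. assert (H1 := qint_S_pos q n hq). assert (H2 := qfact_pos q n hq).
  rewrite one_sub_pow by exact hq. change (qfact q (S n)) with (qint q (S n) * qfact q n).
  field. lra.
Qed.

(** This sequence is the ratio of consecutive coefficients of [qexp]; its limit
    gives the radius of convergence [1 / (1 - q)]. *)
Lemma is_lim_qint (q : R) : 0 < q < 1 ->
  is_lim_seq (fun n => / qint q (S n)) (1 - q).
Proof.
  intros hq.
  apply is_lim_seq_ext with (fun n => (1 - q) * / (1 - q ^ S n)).
  { intros n. unfold qint. assert (H := qint_S_pos q n hq).
    unfold qint in H.
    assert (0 < 1 - q ^ S n).
    { replace (1 - q ^ S n) with ((1 - q ^ S n) / (1 - q) * (1 - q)) by (field; lra).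
      apply Rmult_lt_0_compat; lra. }
    field. lra. }
  replace (Finite (1 - q)) with (Rbar_mult (1 - q) (Rbar_inv (1 - 0))).
  2:{ simpl. f_equal. field. }
  apply is_lim_seq_scal_l.
  apply is_lim_seq_inv.
  - apply is_lim_seq_minus'; [apply is_lim_seq_const|].
    apply (is_lim_seq_incr_1 (fun n => q ^ n)).
    apply is_lim_seq_geom. rewrite Rabs_pos_eq; lra.
  - simpl. intros H. injection H. lra.
Qed.

Lemma CV_radius_qexp (q : R) : 0 < q < 1 ->
  CV_radius (fun n => / qfact q n) = / (1 - q).
Proof.
  intros hq. apply CV_radius_finite_DAlembert.
  - intros n. apply Rinv_neq_0_compat. assert (H := qfact_pos q n hq). lra.
  - lra.
  - apply is_lim_seq_ext with (2 := is_lim_qint q hq).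
    intros n. assert (H := qfact_pos q n hq). assert (H1 := qint_S_pos q n hq).
    simpl qfact. rewrite Rabs_pos_eq.
    + field. lra.
    + apply Rdiv_le_0_compat; [left|]; apply Rinv_0_lt_compat; nra.
Qed.

Definition qExp_coef (q : R) (n : nat) : R := q ^ (n * (n - 1) / 2) / qfact q n.

Lemma qExp_coef_S (q : R) (n : nat) : 0 < q < 1 ->
  qExp_coef q (S n) = q ^ n / qint q (S n) * qExp_coef q n.
Proof.
  intros hq. unfold qExp_coef.
  replace (S n * (S n - 1) / 2)%nat with (n + n * (n - 1) / 2)%nat.
  - assert (H := qfact_pos q n hq). assert (H1 := qint_S_pos q n hq).
    rewrite pow_add. simpl qfact. field. lra.
  - replace (S n * (S n - 1))%nat with (n * 2 + n * (n - 1))%nat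
      by (destruct n; simpl; lia).
    rewrite Nat.add_comm, (Nat.add_comm (n * 2)), Nat.div_add by lia. reflexivity.
Qed.

Lemma qExp_coef_pos (q : R) (n : nat) : 0 < q < 1 -> 0 < qExp_coef q n.
Proof.
  intros hq. apply Rdiv_lt_0_compat; [apply pow_lt; lra | apply qfact_pos; lra].
Qed.

Lemma CV_radius_qExp (q : R) : 0 < q < 1 -> CV_radius (qExp_coef q) = p_infty.
Proof.
  intros hq. apply CV_radius_infinite_DAlembert.
  - intros n. assert (H := qExp_coef_pos q n hq). lra.
  - apply is_lim_seq_ext with (fun n => q ^ n * / qint q (S n)).
    + intros n. assert (H := qExp_coef_pos q n hq). assert (H1 := qint_S_pos q n hq).
      assert (H2 : 0 < q ^ n) by (apply pow_lt; lra).
      rewrite qExp_coef_S by exact hq. rewrite Rabs_pos_eq.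
      * field. lra.
      * apply Rdiv_le_0_compat; [|exact H]. apply Rmult_le_pos; [|lra].
        apply Rdiv_le_0_compat; lra.
    + replace 0 with (0 * (1 - q)) by ring.
      apply is_lim_seq_mult'; [|apply is_lim_qint; exact hq].
      apply is_lim_seq_geom. rewrite Rabs_pos_eq; lra.
Qed.

Lemma qexp_PSeries (q x : R) : qexp q x = PSeries (fun n => / qfact q n) x.
Proof. apply Series_ext. intros n. apply Rmult_comm. Qed.

Lemma qExp_PSeries (q x : R) : qExp q x = PSeries (qExp_coef q) x.
Proof. apply Series_ext. intros n. unfold qExp_coef, Rdiv. ring. Qed.

Lemma qexp_series (q x : R) : 0 < q < 1 -> Rabs x * (1 - q) < 1 ->
  is_series (fun n => x ^ n / qfact q n) (qexp q x).
Proof.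
  intros hq hx. apply Series_correct.
  apply ex_series_ext with (fun n => / qfact q n * x ^ n); [intros; apply Rmult_comm|].
  apply ex_pseries_R, CV_radius_inside. rewrite CV_radius_qexp by exact hq. simpl.
  apply Rmult_lt_reg_r with (1 - q); [lra|]. rewrite Rinv_l; lra.
Qed.

Lemma qExp_series (q x : R) : 0 < q < 1 ->
  is_series (fun n => qExp_coef q n * x ^ n) (qExp q x).
Proof.
  intros hq. rewrite qExp_PSeries. apply Series_correct.
  apply ex_pseries_R, CV_radius_inside. rewrite CV_radius_qExp by exact hq. exact I.
Qed.

(** Subtracting the series at [q x] from that at [x] multiplies the coefficient of
    index [n + 1] by [1 - q ^ (n + 1) = (1 - q) [n + 1]_q], which cancels the last
    factor of [[n + 1]_q!] and leaves the coefficient of index [n]. *)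
Lemma qexp_dilate (q x : R) : 0 < q < 1 -> Rabs x * (1 - q) < 1 ->
  qexp q (q * x) = (1 - (1 - q) * x) * qexp q x.
Proof.
  intros hq hx.
  assert (hx' : Rabs (q * x) * (1 - q) < 1).
  { rewrite Rabs_mult, (Rabs_pos_eq q) by lra. assert (H := Rabs_pos x). nra. }
  assert (H1 := qexp_series q x hq hx). assert (H2 := qexp_series q (q * x) hq hx').
  assert (H3 := is_series_lin 1 (-1) _ _ _ _ H1 H2).
  assert (H4 := is_series_unique _ _ H3).
  erewrite is_series_unique in H4.
  2:{ apply is_series_shift with (c := (1 - q) * x) (1 := H1).
      - simpl. field.
      - intros n. rewrite Rpow_mult_distr.
        transitivity (x ^ S n * ((1 - q ^ S n) / qfact q (S n))).
        + field. assert (H' := qfact_pos q (S n) hq). lra.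
        + rewrite (one_sub_pow_div_qfact q n hq). simpl pow. field.
          assert (H' := qfact_pos q n hq). lra. }
  lra.
Qed.

Lemma qExp_dilate (q x : R) : 0 < q < 1 ->
  qExp q x = (1 + (1 - q) * x) * qExp q (q * x).
Proof.
  intros hq.
  assert (H1 := qExp_series q x hq). assert (H2 := qExp_series q (q * x) hq).
  assert (H3 := is_series_lin 1 (-1) _ _ _ _ H1 H2).
  assert (H4 := is_series_unique _ _ H3).
  erewrite is_series_unique in H4.
  2:{ apply is_series_shift with (c := (1 - q) * x) (1 := H2).
      - simpl. field.
      - intros n. rewrite !Rpow_mult_distr, qExp_coef_S by exact hq.
        assert (H := qint_S_pos q n hq).
        transitivity ((1 - q ^ S n) * (q ^ n / qint q (S n) * qExp_coef q n * x ^ S n));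
          [ring|].
        rewrite one_sub_pow by exact hq.
        simpl pow. field. lra. }
  lra.
Qed.

(** The two dilation formulas carry the same factor [1 - (1 - q) x], on opposite
    sides, so the product is unchanged when [x] is replaced by [q x].  Iterating
    moves the argument to [0], where the product is [1] and continuous. *)
Lemma qexp_mul_qExp_opp (q x : R) : 0 < q < 1 -> Rabs x * (1 - q) < 1 ->
  qexp q x * qExp q (- x) = 1.
Proof.
  intros hq hx.
  set (h := fun z => qexp q z * qExp q (- z)).
  assert (Hinv : forall m, h (q ^ m * x) = h x).
  { induction m as [|m IH]; [f_equal; simpl; ring|].
    rewrite <- IH. simpl. rewrite Rmult_assoc. set (z := q ^ m * x).
    assert (hz : Rabs z * (1 - q) < 1).
    { unfold z. rewrite Rabs_mult, (Rabs_pos_eq (q ^ m)) by (apply pow_le; lra).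
      assert (q ^ m <= 1) by (rewrite <- (pow1 m); apply pow_incr; lra).
      assert (0 <= q ^ m) by (apply pow_le; lra).
      assert (Hx0 := Rabs_pos x).
      apply Rle_lt_trans with (1 * Rabs x * (1 - q)); [|lra].
      repeat apply Rmult_le_compat_r; lra. }
    unfold h. rewrite (qexp_dilate q z hq hz), (qExp_dilate q (- z) hq).
    replace (- (q * z)) with (q * - z) by ring. ring. }
  assert (Hlim0 : is_lim_seq (fun m => q ^ m * x) 0).
  { replace 0 with (0 * x) by ring.
    apply is_lim_seq_mult'; [|apply is_lim_seq_const].
    apply is_lim_seq_geom. rewrite Rabs_pos_eq; lra. }
  assert (Hlim : is_lim_seq (fun m => h (q ^ m * x)) (h 0)).
  { apply is_lim_seq_mult'.
    - rewrite qexp_PSeries.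
      apply is_lim_seq_ext with (fun m => PSeries (fun n => / qfact q n) (q ^ m * x)).
      { intros m. symmetry. apply qexp_PSeries. }
      apply is_lim_seq_continuous; [|exact Hlim0].
      apply PSeries_continuity. rewrite CV_radius_qexp, Rabs_R0 by exact hq.
      simpl. apply Rinv_0_lt_compat. lra.
    - rewrite qExp_PSeries.
      apply is_lim_seq_ext with (fun m => PSeries (qExp_coef q) (- (q ^ m * x))).
      { intros m. symmetry. apply qExp_PSeries. }
      apply is_lim_seq_continuous.
      + apply PSeries_continuity. rewrite CV_radius_qExp by exact hq. exact I.
      + apply (is_lim_seq_opp _ 0). exact Hlim0. }
  assert (h0 : h 0 = 1).
  { unfold h. rewrite qexp_PSeries, Ropp_0, qExp_PSeries, !PSeries_0.
    unfold qExp_coef. simpl. field. }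
  apply is_lim_seq_unique in Hlim.
  rewrite (Lim_seq_ext _ _ Hinv), Lim_seq_const in Hlim.
  injection Hlim. unfold h at 1. congruence.
Qed.

(** * The q-Appell polynomials *)

Lemma is_pseries_CV_radius (c : nat -> R) (u v l : R) :
  is_pseries c u l -> Rabs v < Rabs u -> Rbar_lt (Rabs v) (CV_radius c).
Proof.
  intros H Hv. apply Rbar_lt_le_trans with (Rabs u); [exact Hv|].
  apply Rbar_not_lt_le. intros Hc.
  apply (CV_disk_outside c u Hc), ex_series_lim_0.
  exists l. apply is_pseries_R. exact H.
Qed.

Lemma qexp_pseries (q y u : R) : 0 < q < 1 -> Rabs y * Rabs u * (1 - q) < 1 ->
  is_pseries (fun n => y ^ n / qfact q n) u (qexp q (y * u)).
Proof.
  intros hq hyu. apply is_pseries_R.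
  apply is_series_eq with (fun n => (y * u) ^ n / qfact q n) (qexp q (y * u)).
  - apply qexp_series; [exact hq|]. rewrite Rabs_mult. exact hyu.
  - intros n. rewrite Rpow_mult_distr. field. assert (H := qfact_pos q n hq). lra.
  - reflexivity.
Qed.

(** Stated through [|u| < CV_radius] because Cauchy products and uniqueness of
    coefficients both ask for convergence strictly beyond the point. *)
Lemma qexp_coef_CV_radius (q y u : R) : 0 < q < 1 ->
  Rabs y * Rabs u * (1 - q) < 1 ->
  Rbar_lt (Rabs u) (CV_radius (fun n => y ^ n / qfact q n)).
Proof.
  intros hq hyu.
  assert (Hy := Rabs_pos y). assert (Hu := Rabs_pos u).
  (* A point beyond |u| that still satisfies the hypothesis on u, also for y = 0. *)
  set (w := Rabs u + (1 - Rabs y * Rabs u * (1 - q)) / (1 + Rabs y)).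
  assert (Hw : Rabs u < w).
  { unfold w. assert (0 < (1 - Rabs y * Rabs u * (1 - q)) / (1 + Rabs y))
      by (apply Rdiv_lt_0_compat; lra). lra. }
  apply is_pseries_CV_radius with w (qexp q (y * w)).
  - apply qexp_pseries; [exact hq|]. rewrite (Rabs_pos_eq w) by lra.
    unfold w. set (e := (1 - Rabs y * Rabs u * (1 - q)) / (1 + Rabs y)).
    assert (He : e * (1 + Rabs y) = 1 - Rabs y * Rabs u * (1 - q))
      by (unfold e; field; lra).
    assert (He0 : 0 < e) by (apply Rdiv_lt_0_compat; lra).
    assert (0 <= e * Rabs y) by nra.
    nra.
  - rewrite (Rabs_pos_eq w) by lra. exact Hw.
Qed.

Lemma power_series_CV_radius (a : nat -> R) (A : R -> R) (r u : R) :
  (forall u : R, Rabs u < r -> is_pseries a u (A u)) -> Rabs u < r ->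
  Rbar_lt (Rabs u) (CV_radius a).
Proof.
  intros hA hu. assert (Hu := Rabs_pos u).
  assert (E : Rabs ((Rabs u + r) / 2) = (Rabs u + r) / 2) by (apply Rabs_pos_eq; lra).
  apply is_pseries_CV_radius with ((Rabs u + r) / 2) (A ((Rabs u + r) / 2)).
  - apply hA. rewrite E. lra.
  - rewrite E. lra.
Qed.

Lemma appell_product_pseries (q : R) (a : nat -> R) (A : R -> R) (r y u : R) :
  0 < q < 1 -> (forall u : R, Rabs u < r -> is_pseries a u (A u)) ->
  Rabs u < r -> Rabs y * Rabs u * (1 - q) < 1 ->
  is_pseries (PS_mult a (fun n => y ^ n / qfact q n)) u (A u * qexp q (y * u)).
Proof.
  intros hq hA hu hyu. apply is_pseries_mult.
  - apply hA, hu.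
  - apply qexp_pseries; assumption.
  - apply power_series_CV_radius with A r; assumption.
  - apply qexp_coef_CV_radius; assumption.
Qed.

(** The generating relation holds near [u = 0] only; uniqueness of power series
    coefficients extracts from it the explicit form
    [P_k(y) / [k]_q! = sum_i a_i y^(k-i) / [k-i]_q!], from which the relation
    extends to every [u] where both factors converge. *)
Lemma appell_coef (q : R) (a : nat -> R) (A : R -> R) (r : R) (P : nat -> R -> R) :
  0 < q < 1 -> 0 < r -> (forall u : R, Rabs u < r -> is_pseries a u (A u)) ->
  is_qAppell q A P ->
  forall k y, P k y / qfact q k = PS_mult a (fun n => y ^ n / qfact q n) k.
Proof.
  intros hq hr hA hP k y.
  destruct (hP y) as [eps Heps].
  assert (Hy := Rabs_pos y).
  set (d := Rmin (Rmin eps r) (/ (1 + Rabs y))).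
  assert (Hd : 0 < d <= eps /\ d <= r /\ d * (1 + Rabs y) <= 1).
  { assert (Hi : 0 < / (1 + Rabs y)) by (apply Rinv_0_lt_compat; lra).
    assert (H1 := Rmin_l (Rmin eps r) (/ (1 + Rabs y))).
    assert (H2 := Rmin_r (Rmin eps r) (/ (1 + Rabs y))).
    assert (H3 := Rmin_l eps r). assert (H4 := Rmin_r eps r).
    fold d in H1, H2.
    assert (0 < d) by (repeat apply Rmin_glb_lt; try lra; apply cond_pos).
    repeat split; try lra.
    replace 1 with (/ (1 + Rabs y) * (1 + Rabs y)) at 2 by (field; lra).
    apply Rmult_le_compat_r; lra. }
  assert (Hprod : forall u, Rabs u < d ->
    is_pseries (PS_mult a (fun n => y ^ n / qfact q n)) u (A u * qexp q (y * u))).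
  { intros u hu. apply appell_product_pseries with r; try assumption; [lra|].
    assert (Hu := Rabs_pos u). assert (0 <= Rabs y * Rabs u) by nra. nra. }
  assert (HPu : forall u, Rabs u < d ->
    is_pseries (fun k => P k y / qfact q k) u (A u * qexp q (y * u))).
  { intros u hu. apply Heps. unfold ball; simpl; unfold AbsRing_ball; simpl.
    unfold abs, minus, plus, opp; simpl. rewrite Ropp_0, Rplus_0_r. lra. }
  assert (E : Rabs (d / 2) = d / 2) by (apply Rabs_pos_eq; lra).
  apply (PSeries_ext_recip (fun k => P k y / qfact q k)).
  - rewrite <- Rabs_R0.
    apply is_pseries_CV_radius with (1 := HPu (d / 2) ltac:(lra)).
    rewrite E, Rabs_R0. lra.
  - rewrite <- Rabs_R0.
    apply is_pseries_CV_radius with (1 := Hprod (d / 2) ltac:(lra)).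
    rewrite E, Rabs_R0. lra.
  - exists (mkposreal d (proj1 (proj1 Hd))). intros u hu.
    assert (hu' : Rabs u < d).
    { unfold ball in hu; simpl in hu; unfold AbsRing_ball in hu; simpl in hu.
      unfold abs, minus, plus, opp in hu; simpl in hu.
      rewrite Ropp_0, Rplus_0_r in hu. exact hu. }
    rewrite (is_pseries_unique _ _ _ (HPu u hu')).
    symmetry. apply is_pseries_unique, Hprod, hu'.
Qed.

Lemma appell_series (q : R) (a : nat -> R) (A : R -> R) (r : R)
    (P : nat -> R -> R) (y u : R) :
  0 < q < 1 -> (forall u : R, Rabs u < r -> is_pseries a u (A u)) ->
  is_qAppell q A P -> Rabs u < r -> Rabs y * Rabs u * (1 - q) < 1 ->
  is_series (fun k => P k y / qfact q k * u ^ k) (A u * qexp q (y * u)).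
Proof.
  intros hq hA hP hu hyu. assert (Hu := Rabs_pos u).
  apply is_pseries_R.
  apply is_pseries_ext with (2 := appell_product_pseries q a A r y u hq hA hu hyu).
  intros k. symmetry. apply appell_coef with A r; try assumption. lra.
Qed.

(** At [y = 0] the q-exponential is [1], so that [P_k(0) / [k]_q! = a_k]. *)
Lemma appell_coef_nonneg (q : R) (a : nat -> R) (A : R -> R) (r : R)
    (P : nat -> R -> R) :
  0 < q < 1 -> 0 < r -> (forall u : R, Rabs u < r -> is_pseries a u (A u)) ->
  is_qAppell q A P -> (forall (k : nat) (y : R), 0 <= y -> 0 <= P k y) ->
  forall k, 0 <= a k.
Proof.
  intros hq hr hA hP hpos k.
  assert (E : PS_mult a (fun n => 0 ^ n / qfact q n) k = a k).
  { unfold PS_mult. destruct k as [|k]; [simpl; field|].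
    rewrite tech5, Nat.sub_diag.
    replace (sum_f_R0 _ k) with 0; [simpl; field|].
    symmetry. apply sum_eq_R0. intros i Hi.
    rewrite (pow_i (S k - i)) by lia. unfold Rdiv. ring. }
  rewrite <- E, <- (appell_coef q a A r P hq hr hA hP k 0).
  apply Rdiv_le_0_compat; [apply hpos, Rle_refl | apply qfact_pos; exact hq].
Qed.

Lemma power_series_at_qpow (a : nat -> R) (A : R -> R) (r q : R) (m : nat) :
  0 < q < 1 -> 1 < r -> (forall u : R, Rabs u < r -> is_pseries a u (A u)) ->
  is_series (fun k => a k * (q ^ m) ^ k) (A (q ^ m)).
Proof.
  intros hq hr hA. apply is_pseries_R, hA.
  assert (0 <= q ^ m) by (apply pow_le; lra).
  assert (q ^ m <= 1) by (rewrite <- (pow1 m); apply pow_incr; lra).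
  rewrite Rabs_pos_eq; lra.
Qed.

(** With nonnegative coefficients every q-derivative is nonnegative at
    nonnegative points.  For the second one the coefficients that appear are
    [a_k (q - q^k) (1 - q^k)]; the case [k = 0], where the first factor is
    negative, is saved by the second factor. *)
Lemma Dq_pos_coef (a : nat -> R) (A : R -> R) (r q : R) :
  0 < q < 1 -> 1 < r -> (forall u : R, Rabs u < r -> is_pseries a u (A u)) ->
  (forall k, 0 <= a k) ->
  0 <= A 1 /\ 0 <= Dq q A q /\ 0 <= Dq q (Dq q A) 1.
Proof.
  intros hq hr hA ha.
  assert (H0 := power_series_at_qpow a A r q 0 hq hr hA).
  assert (H1 := power_series_at_qpow a A r q 1 hq hr hA).
  assert (H2 := power_series_at_qpow a A r q 2 hq hr hA).
  replace (q ^ 0) with 1 in H0 by ring.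
  replace (q ^ 1) with q in H1 by ring.
  replace (q ^ 2) with (q * q) in H2 by ring.
  assert (Hz : is_series (fun _ : nat => 0) 0).
  { apply is_series_eq with (1 := is_series_lin 0 0 _ _ _ _ H0 H0); intros; ring. }
  assert (Hpow : forall k, 0 <= q ^ k <= 1).
  { intros k. split; [apply pow_le; lra|].
    rewrite <- (pow1 k); apply pow_incr; lra. }
  assert (Hmono : A (q * q) <= A q).
  { apply (fun H => is_series_le _ _ _ _ H H2 H1). intros k.
    apply Rmult_le_compat_l; [apply ha|].
    rewrite Rpow_mult_distr. assert (H := Hpow k). nra. }
  assert (Hconv : 0 <= q * (A 1 - A q) - (A q - A (q * q))).
  { assert (HL := is_series_lin 1 (-1) _ _ _ _ H0 H1).
    assert (HR := is_series_lin 1 (-1) _ _ _ _ H1 H2).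
    assert (HH := is_series_lin q (-1) _ _ _ _ HL HR).
    apply Rle_trans with (q * (1 * A 1 + -1 * A q) + -1 * (1 * A q + -1 * A (q * q)));
      [|apply Req_le; ring].
    apply (fun H => is_series_le _ _ _ _ H Hz HH). intros k.
    rewrite pow1, Rpow_mult_distr.
    replace (_ + _) with (a k * ((q - q ^ k) * (1 - q ^ k))) by ring.
    apply Rmult_le_pos; [apply ha|].
    destruct k as [|k]; [simpl; lra|].
    apply Rmult_le_pos; [|assert (H := Hpow (S k)); lra].
    simpl. assert (H := Hpow k). nra. }
  repeat split.
  - apply (fun H => is_series_le _ _ _ _ H Hz H0). intros k.
    rewrite pow1, Rmult_1_r. apply ha.
  - unfold Dq. destruct (Req_dec_T q 0) as [|_]; [lra|].
    apply Rdiv_le_0_compat; nra.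
  - unfold Dq. destruct (Req_dec_T 1 0) as [|_]; [lra|].
    destruct (Req_dec_T (q * 1) 0) as [|_]; [lra|].
    rewrite !Rmult_1_r.
    replace (_ / (1 - q)) with
      ((q * (A 1 - A q) - (A q - A (q * q))) / (q * (1 - q) * (1 - q)))
      by (field; lra).
    apply Rdiv_le_0_compat; [exact Hconv|].
    repeat apply Rmult_lt_0_compat; lra.
Qed.

Lemma pow_div_qfact_ge_1 (q y : R) (n : nat) : 0 < q < 1 -> 1 <= y * (1 - q) ->
  1 <= y ^ n / qfact q n.
Proof.
  intros hq hy. induction n as [|n IH]; [simpl; lra|].
  assert (Hf := qfact_pos q n hq). assert (Hi := qint_S_pos q n hq).
  assert (Hb := qint_bounds q (S n) hq).
  assert (H1 : 1 <= y / qint q (S n)).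
  { apply Rmult_le_reg_r with (qint q (S n)); [exact Hi|].
    replace (y / qint q (S n) * qint q (S n)) with y by (field; lra).
    rewrite Rmult_1_l. apply Rlt_le, Rlt_le_trans with (1 := proj2 Hb).
    apply Rmult_le_reg_r with (1 - q); [lra|]. rewrite Rinv_l; lra. }
  replace (y ^ S n / qfact q (S n))
    with (y / qint q (S n) * (y ^ n / qfact q n)) by (simpl; field; lra).
  rewrite <- (Rmult_1_l 1). apply Rmult_le_compat; lra.
Qed.

(** If [(1 - q) y >= 1], then all terms [y^n / [n]_q!] are at least [1], so the
    k-th coefficient dominates the partial sum [a_0 + ... + a_k], which tends to
    [A(1) > 0]; a convergent series cannot have such terms. *)
Lemma appell_convergence (q : R) (a : nat -> R) (A : R -> R) (r : R)
    (P : nat -> R -> R) (y : R) :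
  0 < q < 1 -> 1 < r -> (forall u : R, Rabs u < r -> is_pseries a u (A u)) ->
  (forall k, 0 <= a k) -> 0 < A 1 -> is_qAppell q A P ->
  ex_series (fun k => P k y / qfact q k) -> y * (1 - q) < 1.
Proof.
  intros hq hr hA ha hA1 hP Hex.
  apply Rnot_le_lt. intros hy.
  assert (H1 := power_series_at_qpow a A r q 0 hq hr hA).
  assert (HH : Rbar_le (A (q ^ 0)) 0); [|simpl in HH; lra].
  apply is_lim_seq_le with (2 := H1) (3 := ex_series_lim_0 _ Hex).
  intros n. rewrite sum_n_Reals, (appell_coef q a A r P) by (assumption || lra).
  apply sum_Rle. intros k Hk.
  assert (H := pow_div_qfact_ge_1 q y (n - k) hq hy).
  simpl pow at 1. rewrite pow1. apply Rmult_le_compat_l; [apply ha | exact H].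
Qed.

(** * Rate of convergence *)

Lemma exists_pow2_ge (X : R) : exists m : nat, X <= 2 ^ m.
Proof.
  destruct (Pow_x_infinity 2 ltac:(rewrite Rabs_pos_eq; lra) X) as [m Hm].
  exists m. specialize (Hm m (Nat.le_refl m)).
  rewrite Rabs_pos_eq in Hm by (apply pow_le; lra). lra.
Qed.

Theorem theorem5p1
    (q : R) (hq : 0 < q < 1)
    (b : nat -> R)
    (hb_pos : forall n : nat, (1 <= n)%nat -> 0 < b n)
    (hb_incr : forall n : nat, (1 <= n)%nat -> b n <= b (S n))
    (hb_lim : is_lim_seq b p_infty)
    (hb_o : is_lim_seq (fun n => b n / INR n) 0)
    (a : nat -> R) (A : R -> R) (r : R) (hr : 1 < r)
    (hA : forall u : R, Rabs u < r -> is_pseries a u (A u))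
    (hA1 : A 1 <> 0)
    (P : nat -> R -> R)
    (hP : is_qAppell q A P)
    (hP_pos : forall (k : nat) (y : R), 0 <= y -> 0 <= P k y) :
  exists K : R, 0 < K /\
    forall (n : nat) (x : R) (f : R -> R),
      (1 <= n)%nat -> 0 <= x -> CB f ->
      FS_defined q b P n x ->
      0 < phi q b A n ->
      0 < Dq q A 1 / A 1 * (b n / qint q n) ->
      Rabs (FS q b A P n f x - f x)
      <= K * omega2 f (phi q b A n)
         + omega f (Dq q A 1 / A 1 * (b n / qint q n)).
Proof.
  set (d := Dq q A 1 / A 1).
  destruct (exists_pow2_ge (/ (d * (1 - q)))) as [m Hm].
  (* [m] is chosen so that 2^m phi_n is at least the length of the interval
     containing all nodes, and each doubling of the step costs a factor 4. *)
  exists (2 * 4 ^ m). split.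
  { assert (0 < 4 ^ m) by (apply pow_lt; lra). lra. }
  intros n x f hn hx [HC0 [M HM]] Hdef Hphi Hd.
  assert (ha := appell_coef_nonneg q a A r P hq ltac:(lra) hA hP hP_pos).
  destruct (Dq_pos_coef a A r q hq hr hA ha) as (HA1 & HD & HDD).
  assert (HA1' : 0 < A 1) by lra. clear HA1.
  assert (Hqn : 0 < qint q n) by (destruct n; [lia | apply qint_S_pos; exact hq]).
  assert (Hbn := hb_pos n hn).
  set (beta := b n / qint q n) in *.
  assert (Hbeta : 0 < beta) by (apply Rdiv_lt_0_compat; assumption).
  assert (Hd0 : 0 < d) by nra.
  set (y := qint q n / b n * x).
  assert (Hy : 0 <= y).
  { apply Rmult_le_pos; [|exact hx]. apply Rdiv_le_0_compat; lra. }
  assert (Hxy : x = beta * y) by (unfold beta, y; field; lra).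
  set (p := fun k => P k y / qfact q k).
  assert (Hp : forall k, 0 <= p k).
  { intros k. apply Rdiv_le_0_compat; [apply hP_pos, Hy | apply qfact_pos, hq]. }
  assert (Hex : ex_series p).
  { assert (HC : CB (fun _ => 1)).
    { split.
      - intros t _. apply filterlim_const.
      - exists 1. intros t _. rewrite Rabs_R1. lra. }
    apply ex_series_ext with (2 := Hdef _ HC).
    intros k. apply Rmult_1_r. }
  assert (Hs := appell_convergence q a A r P y hq hr hA ha HA1' hP Hex).
  assert (Hs' : Rabs y * (1 - q) < 1) by (rewrite Rabs_pos_eq; assumption).
  assert (Hmass : is_series p (A 1 * qexp q y)).
  { apply is_series_eq with (fun k => p k * 1 ^ k) (A 1 * qexp q (y * 1)).
    - apply (appell_series q a A r P y 1 hq hA hP); rewrite Rabs_R1; lra.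
    - intros k. rewrite pow1. ring.
    - rewrite Rmult_1_r. reflexivity. }
  assert (Hmassq : is_series (fun k => p k * q ^ k)
            (A q * ((1 - (1 - q) * y) * qexp q y))).
  { apply is_series_eq with (fun k => p k * q ^ k) (A q * qexp q (y * q)).
    - apply (appell_series q a A r P y q hq hA hP); rewrite (Rabs_pos_eq q) by lra.
      + lra.
      + assert (H := Rabs_pos y). nra.
    - reflexivity.
    - rewrite (Rmult_comm y q), qexp_dilate by assumption. reflexivity. }
  assert (Hexp := qexp_mul_qExp_opp q y hq Hs').
  assert (He : 0 < qexp q y).
  { assert (H : 0 <= A 1 * qexp q y).
    { replace 0 with (0 * (A 1 * qexp q y) + 0 * (A 1 * qexp q y)) by ring.
      apply (fun H => is_series_le _ _ _ _ H (is_series_lin 0 0 _ _ _ _ Hmass Hmass)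
                                   Hmass).
      intros k. assert (H := Hp k). lra. }
    assert (qexp q y <> 0) by (intros E; rewrite E in Hexp; lra).
    assert (0 <= qexp q y) by nra. lra. }
  set (c := qExp q (- y) / A 1).
  assert (Hc : c = / (A 1 * qexp q y)).
  { unfold c. replace (qExp q (- y)) with (/ qexp q y).
    - field. lra.
    - apply Rmult_eq_reg_l with (qexp q y); [|lra]. rewrite Hexp. field. lra. }
  assert (Hc0 : 0 < c).
  { rewrite Hc. apply Rinv_0_lt_compat, Rmult_lt_0_compat; assumption. }
  set (v := fun k => c * p k).
  set (t := fun k => qint q k / qint q n * b n).
  assert (Ht : forall k, t k = beta * qint q k).
  { intros k. unfold t, beta. field. lra. }
  (* The barycentre of the nodes is x + shift. *)
  set (shift := d * beta * (1 - y * (1 - q))).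
  set (T := beta / (1 - q)).
  assert (HTphi : T <= 2 * (2 ^ m * phi q b A n)).
  { assert (Hphi' : d * beta <= phi q b A n).
    { unfold phi. fold d.
      replace (b n ^ 2 / qint q n ^ 2) with (beta ^ 2)
        by (unfold beta; field; lra).
      fold beta.
      replace ((q * Dq q A q + Dq q A 1) / A 1 * beta)
        with (q * Dq q A q / A 1 * beta + d * beta) by (unfold d; field; lra).
      assert (0 <= q * Dq q A q / A 1 * beta).
      { apply Rmult_le_pos; [|lra]. apply Rdiv_le_0_compat; [|exact HA1'].
        apply Rmult_le_pos; lra. }
      assert (0 <= (A 1 * Dq q (Dq q A) 1 + Dq q A 1 ^ 2) / A 1 ^ 2 * beta ^ 2).
      { apply Rmult_le_pos; [|apply pow2_ge_0].
        apply Rdiv_le_0_compat; [|apply pow_lt, HA1'].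
        assert (Hsq := pow2_ge_0 (Dq q A 1)).
        assert (0 <= A 1 * Dq q (Dq q A) 1) by (apply Rmult_le_pos; lra).
        lra. }
      lra. }
    assert (H2 : 0 <= 2 ^ m) by (apply pow_le; lra).
    assert (HTd : T = / (d * (1 - q)) * (d * beta)) by (unfold T; field; lra).
    assert (0 < / (d * (1 - q)))
      by (apply Rinv_0_lt_compat, Rmult_lt_0_compat; lra).
    assert (T <= 2 ^ m * phi q b A n).
    { rewrite HTd. apply Rmult_le_compat; lra. }
    assert (0 <= 2 ^ m * phi q b A n) by (apply Rmult_le_pos; lra).
    lra. }
  assert (HW := second_diff_pow2 f _ _ m (omega2_bound f M (phi q b A n) HM)).
  assert (HT0 : 0 < T) by (apply Rdiv_lt_0_compat; lra).
  destruct (near_affine f M _ _ T HM HW (conj HT0 HTphi)) as (al & be & Haff).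
  assert (Hdev : Rabs (FS q b A P n f x - f (x + shift))
                 <= 2 * (4 ^ m * omega2 f (phi q b A n))).
  { apply average_deviation with v t T al be; [| | | | |exact Haff].
    - intros k. apply Rmult_le_pos; [lra | apply Hp].
    - intros k. rewrite Ht. assert (H := qint_bounds q k hq). split.
      + apply Rmult_le_pos; lra.
      + apply Rmult_le_compat_l; lra.
    - apply is_series_eq with (1 := is_series_scal c _ _ Hmass).
      + reflexivity.
      + change (c * (A 1 * qexp q y) = 1). rewrite Hc. field. lra.
    - apply is_series_eq with (1 := is_series_lin (c * beta / (1 - q))
        (- (c * beta / (1 - q))) _ _ _ _ Hmass Hmassq).
      + intros k. rewrite Ht. unfold v, qint. field. lra.
      + rewrite Hc, Hxy. unfold shift, d, Dq.
        destruct (Req_dec_T 1 0) as [|_]; [lra|]. rewrite !Rmult_1_r.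
        field. lra.
    - apply is_series_eq with
        (1 := is_series_scal c _ _ (Series_correct _ (Hdef f (conj HC0 (ex_intro _ M HM))))).
      + intros k. unfold v, t, FS_term. fold y. unfold p.
        unfold scal; simpl; unfold mult; simpl. ring.
      + reflexivity. }
  assert (Hshift : 0 < shift <= d * beta).
  { unfold shift. assert (0 < d * beta) by (apply Rmult_lt_0_compat; assumption).
    assert (0 <= y * (1 - q)) by (apply Rmult_le_pos; lra).
    split.
    - apply Rmult_lt_0_compat; lra.
    - rewrite <- (Rmult_1_r (d * beta)) at 2. apply Rmult_le_compat_l; lra. }
  assert (Hom := omega_bound f M (d * beta) shift x HM Hshift hx).
  apply Rabs_le_between in Hdev, Hom. apply Rabs_le_between. lra.
Qed.
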